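(* There exists a pertinent group of order $n$ if and only if either $n\equiv 6\pmod{12}$, or $n=4^\alpha m$ with $\alpha>0$ and $m\equiv 3\pmod 6$.
   Context: A finite group is pertinent if it has exactly three involutions (elements of order $2$) and these three involutions are pairwise conjugate in the group. *)

(* Defs.v *)
From HB Require Import structures.
From mathcomp Require Import all_boot all_fingroup.

Set Implicit Arguments.
Unset Strict Implicit.
Unset Printing Implicit Defensive.

Local Open Scope group_scope.

Definition involutions (gT : finGroupType) (G : {group gT}) : {set gT} :=
  [set x in G | #[x] == 2].

Definition pertinent (gT : finGroupType) (G : {group gT}) : Prop :=
  #|involutions G| = 3 /\
  (forall x y, x \in involutions G -> y \in involutions G ->
     exists2 g, g \in G & y = x ^ g).

(* Main.v *)
(* Let [I] be the set of the three involutions of a pertinent group [G], and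
   [C = 'C_G(I)], of index [3] or [6] in [G]. If [C] has odd order, then [#|G|]
   is [6] times an odd number. Otherwise the involutions commute; then no
   involution normalises a Sylow [3]-subgroup, so the Frattini argument applied
   to the subgroup generated by [C] and a Sylow [3]-subgroup rules out index
   [6]. A Sylow [2]-subgroup of [C] is thus Sylow in [G], and a [3]-subgroup
   acts on it without fixed points, so its order is [1] modulo [3], i.e., a
   power of [4].
   Conversely, multiply ['S_3], or the semidirect product of the square of a
   cyclic group of order [2 ^ a] by a cyclic group of order [3], with a cyclic
   group of odd order. *)
Require Import Defs.
From mathcomp Require Import all_boot all_fingroup finalg zmodp all_solvable zify.

Set Implicit Arguments.
Unset Strict Implicit.
Unset Printing Implicit Defensive.

Local Open Scope group_scope.

(** * Elements of order two *)

Lemma order2P (gT : finGroupType) (x : gT) :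
  reflect (x ^+ 2 = 1 /\ x != 1) (#[x] == 2).
Proof.
apply: (iffP eqP) => [ox | [x2 nx]].
  by rewrite -order_eq1 -{1}ox expg_order ox.
by apply/prime_nt_dvdP; rewrite ?order_dvdn ?x2 ?order_eq1.
Qed.

Lemma mem_involutions (gT : finGroupType) (G : {group gT}) x :
  reflect [/\ x \in G, x ^+ 2 = 1 & x != 1] (x \in involutions G).
Proof.
rewrite inE; apply: (iffP andP) => [[Gx /order2P[]] | [Gx x2 nx]] //.
by split=> //; apply/order2P.
Qed.

(** * Necessity: the conjugation action on the three involutions *)

Section Necessity.

Variables (gT : finGroupType) (G : {group gT}).
Hypothesis pertG : pertinent G.

Let I := involutions G.
Let C := 'C_G(I).

Lemma class_involution t : t \in I -> t ^: G = I.
Proof.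
move=> It; apply/eqP; rewrite eqEsubset; apply/andP; split; apply/subsetP=> x.
  case/imsetP=> g Gg ->; case/mem_involutions: It => Gt t2 nt.
  by apply/mem_involutions; rewrite groupJ // -conjXg t2 conj1g conjg_eq1.
by move=> Ix; have [g Gg ->] := pertG.2 _ _ It Ix; rewrite memJ_class.
Qed.

Lemma card_cent_involution t : t \in I -> #|G| = (#|'C_G[t]| * 3)%N.
Proof.
move=> It; rewrite -(Lagrange (subsetIl G 'C[t])) index_cent1.
by rewrite class_involution // /I pertG.1.
Qed.

Lemma sub_cent_involution t : t \in I -> C \subset 'C_G[t].
Proof. by move=> It; rewrite setIS // -cent_set1 centS ?sub1set. Qed.

Lemma involutionJ x g : x \in I -> g \in G -> x ^ g \in I.
Proof. by move=> Ix Gg; rewrite -(class_involution Ix) memJ_class. Qed.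

Lemma cent_involutions_normal : C <| G.
Proof.
apply: norm_normalI; apply: norms_cent.
apply/subsetP=> g Gg; rewrite inE; apply/subsetP=> _ /imsetP[x Ix ->].
exact: involutionJ.
Qed.

Lemma exists_involution : exists t, t \in I.
Proof. by apply/set0Pn; rewrite -card_gt0 /I pertG.1. Qed.

(** [C] is the kernel of the action on [I]. The stabiliser of [a] has index 3, and inside it [C] is
    the stabiliser of a second involution [b], whose orbit avoids [a] and so has at most two
    elements. *)
Lemma index_cent_involutions : #|G : C| = 3 \/ #|G : C| = 6.
Proof.
have [a Ia] := exists_involution.
have /cards2P[b [c [nbc defI]]] : #|I :\ a| == 2.
  by have: #|I| = 3 := pertG.1; rewrite (cardsD1 a) Ia add1n => -[->].
have Ibc x : (x \in I) = [|| x == a, x == b | x == c].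
  by rewrite -(setD1K Ia) defI !inE.
have /setD1P[nac _] : c \in I :\ a by rewrite defI !inE eqxx orbT.
have defC : 'C_('C_G[a])[b] = C.
  apply/eqP; rewrite eqEsubset; apply/andP; split; last first.
    rewrite subsetI sub_cent_involution //= subIset // -cent_set1 centS ?orbT //.
    by rewrite sub1set Ibc eqxx orbT.
  (* A permutation of three points that fixes [a] and [b] also fixes [c]. *)
  apply/subsetP=> g /setIP[/setIP[Gg /cent1P cag] /cent1P cbg].
  have fix_g x : commute g x -> x ^ g = x by move=> cx; rewrite conjgE -cx mulKg.
  rewrite inE Gg; apply/centP=> x; rewrite Ibc => /or3P[] /eqP-> //.
  have: c ^ g \in I by rewrite involutionJ // Ibc eqxx !orbT.
  have eq_cg y : commute g y -> (c ^ g == y) = (c == y).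
    by move=> cy; rewrite -{1}(fix_g y cy) (inj_eq (conjg_inj g)).
  rewrite Ibc (eq_cg a) // (eq_cg b) // (negPf nac) [c == b]eq_sym (negPf nbc).
  move=> /= /eqP cg.
  by rewrite /commute [RHS]conjgC cg.
have : #|'C_G[a] : C| <= 2.
  rewrite -defC index_cent1; have <- : #|I :\ a| = 2 by rewrite defI cards2 nbc.
  apply: subset_leq_card; apply/subsetP=> _ /imsetP[g /setIP[Gg /cent1P cag] ->].
  have /setD1P[nba _] : b \in I :\ a by rewrite defI !inE eqxx.
  rewrite in_setD1 involutionJ ?Ibc ?eqxx ?orbT // andbT.
  by rewrite -(inj_eq (conjg_inj g^-1)) conjgK conjgE invgK mulgA cag mulgK.
have:= Lagrange_index (subsetIl G 'C[a]) (sub_cent_involution Ia).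
rewrite index_cent1 class_involution // -/C => <-.
have:= indexg_gt0 'C_G[a] C; have ->: #|I| = 3 := pertG.1.
by case: #|_ : _| => [|[|[|k]]] // _ _; [left | right].
Qed.

(** Since [G] contains an involution, its order is even; with [C] of odd order the index cannot be
    3, so it is 6. *)
Lemma odd_cent_involutions_order : odd #|C| -> #|G| = 6 %[mod 12].
Proof.
move=> oddC; have [t It] := exists_involution.
have evG : 2 %| #|G|.
  by case/setIdP: It => Gt /eqP <-; apply: order_dvdG.
move: evG; rewrite -(Lagrange (subsetIl G 'C(I))) -/C.
by move: #|C| oddC => k; case: index_cent_involutions => -> *; lia.
Qed.

(** * Necessity: the case where [C] has even order *)

Lemma commute_involutions : ~~ odd #|C| -> {in I &, commutative mulg}.
Proof.
(* One involution [t] lies in [C]; as [C] is normal, all conjugates of [t], that is all of [I], lie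
   in [C]. *)
rewrite -dvdn2 => /(Cauchy (isT : prime 2))[t Ct /eqP ot].
have It : t \in I by rewrite inE ot (subsetP (subsetIl G 'C(I))).
move=> x y Ix; rewrite -(class_involution It) => /imsetP[g Gg ->].
have /setIP[_ /centP-> //] : t ^ g \in C.
by rewrite memJ_norm // (subsetP (normal_norm cent_involutions_normal)).
Qed.

(* An involution [t] normalising [T] would centralise it, as [[~ t, g]] is a
   product of commuting involutions lying in a [3]-group; but centralisers of
   involutions have index [3]. *)
Lemma odd_norm_Sylow3 (T : {group gT}) :
  ~~ odd #|C| -> 3.-Sylow(G) T -> odd #|'N_G(T)|.
Proof.
move=> evC sylT; case oN: (odd _) => //; exfalso.
have /(Cauchy (isT : prime 2))[t /setIP[Gt nTt] /eqP ot] : 2 %| #|'N_G(T)|.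
  by rewrite dvdn2 oN.
have It : t \in I by rewrite inE Gt ot.
have sTG := pHall_sub sylT.
have sTC : T \subset 'C_G[t].
  rewrite subsetI sTG; apply/subsetP=> g Tg; apply/cent1P.
  have Gg := subsetP sTG g Tg; have Itg := involutionJ It Gg.
  have [_ t2 _] := mem_involutions _ _ It.
  have [_ tg2 _] := mem_involutions _ _ Itg.
  have tV : t^-1 = t by apply/eqP; rewrite eq_invg_mul -expg2 t2.
  have R1 : [~ t, g] = 1.
    apply/eqP; rewrite -order_eq1 -dvdn1.
    have /eqP <- : coprime 2 #[[~ t, g]].
      apply: (@pnat_coprime 2) => //.
      apply: (pi_pnat (mem_p_elt (pHall_pgroup sylT) _)) => //.
      by rewrite commgEr groupM // memJ_norm ?groupV.
    rewrite dvdn_gcd dvdnn andbT order_dvdn commgEl tV.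
    by rewrite expgMn ?t2 ?tg2 ?mulg1 //; apply: commute_involutions.
  by have /commgP := introT eqP R1.
have := cardSg sTC; rewrite (card_Hall sylT) (card_cent_involution It).
by rewrite p_part pfactor_dvdn // lognM //= addn1 ltnn.
Qed.

Lemma index_cent_involutions_even : ~~ odd #|C| -> #|G : C| = 3.
Proof.
move=> evC; have [T sylT] := Sylow_exists 3 G.
have nCG := cent_involutions_normal; have [sCG nCG'] := andP nCG.
have sTG := pHall_sub sylT; have nCT := subset_trans sTG nCG'.
have sDG : C <*> T \subset G by rewrite join_subG sCG.
(* The index of [C <*> T] divides 6 and is prime to 3, so it is 1 or 2. *)
have n3 : ~~ (3 %| #|G : C <*> T|).
  rewrite -p'natE //; apply: pnat_dvd (indexgS G (joing_subr _ _)) _.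
  by have /and3P[_ _] := sylT.
have iD6 : #|G : C <*> T| %| 6.
  apply: dvdn_trans (indexgS G (joing_subl C T)) _.
  by case: index_cent_involutions => ->.
(* With index 2, [C <*> T] would be normal, and by Frattini ['N_G(T)] would meet it in a subgroup of
   index 2, although ['N_G(T)] has odd order. *)
have iD2 : #|G : C <*> T| != 2.
  apply/negP => /eqP iD2; have nD := index2_normal sDG iD2.
  have sylTD : 3.-Sylow(C <*> T) T := pHall_subl (joing_subr _ _) sDG sylT.
  have defG := Frattini_arg nD sylTD.
  have /eqP : (#|C <*> T| * #|'N_G(T) : C <*> T| = #|C <*> T| * #|G : C <*> T|)%N.
    by rewrite LagrangeMl defG Lagrange.
  rewrite eqn_pmul2l // iD2 => /eqP iN.
  have := dvdn_indexg 'N_G(T) (C <*> T); rewrite iN dvdn2.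
  by rewrite (odd_norm_Sylow3 evC sylT).
have iD1 : #|G : C <*> T| = 1%N.
  have := dvdn_leq (isT : 0 < 6) iD6; move: n3 iD6 iD2.
  by case: #|G : _| => [|[|[|[|[|[|[|]]]]]]].
(* Now [G] is the product of [C] and [T], so [#|G : C|] is a power of 3, which excludes 6. *)
have /eqP : (#|C| * #|T : C| = #|C| * #|G : C|)%N.
  rewrite LagrangeMl -norm_joinEr // (Lagrange sCG).
  by rewrite -(Lagrange sDG) iD1 muln1.
rewrite eqn_pmul2l // => /eqP iTC.
have : 3.-nat #|G : C|.
  by rewrite -iTC; apply: pnat_dvd (dvdn_indexg _ _) (pHall_pgroup sylT).
by case: index_cent_involutions => ->.
Qed.

(* A [3]-subgroup normalising a Sylow [2]-subgroup [P] and moving an involution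
   has no nontrivial fixed point in [P]. *)
Lemma card_Sylow2_mod3 (P : {group gT}) :
  ~~ odd #|C| -> 2.-Sylow(C) P -> #|P| = 1 %[mod 3].
Proof.
move=> evC sylP; have iC := index_cent_involutions_even evC.
have nCG := cent_involutions_normal; have [sCG nCG'] := andP nCG.
have defG := Frattini_arg nCG sylP.
(* By Frattini, ['N_G(P)] covers the quotient of [G] by [C]. *)
have iN : #|'N_G(P) : C| = 3.
  have /eqP : (#|C| * #|'N_G(P) : C| = #|C| * #|G : C|)%N.
    by rewrite LagrangeMl defG Lagrange.
  by rewrite eqn_pmul2l // iC => /eqP.
have [T sylT] := Sylow_exists 3 'N_G(P).
have [sTG nPT] := subsetIP (pHall_sub sylT).
(* Otherwise the full 3-part of [#|'N_G(P)|] would divide the order of a subgroup of index 3. *)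
have nTC : ~~ (T \subset C).
  apply/negP=> sTC.
  have : T \subset 'N_G(P) :&: C by rewrite subsetI (pHall_sub sylT).
  move/cardSg; rewrite (card_Hall sylT) -(Lagrange (subsetIl 'N_G(P) C)).
  by rewrite indexgI iN p_part pfactor_dvdn // lognM //= addn1 ltnn.
have actTP : [acts T, on P | 'J] by rewrite astabsJ.
rewrite (pgroup_fix_mod (pHall_pgroup sylT) actTP) afixJ.
suff -> : 'C_P(T) = 1 by rewrite cards1.
apply/eqP; apply/idPn=> ntF.
have pF : 2.-group 'C_P(T) := pgroupS (subsetIl _ _) (pHall_pgroup sylP).
have [_ d2 _] := pgroup_pdiv pF ntF.
have [t /setIP[Pt cTt] /eqP ot] := Cauchy (isT : prime 2) d2.
have Gt : t \in G by rewrite (subsetP (subset_trans (pHall_sub sylP) sCG)).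
have It : t \in I by rewrite inE Gt.
(* Both subgroups have index 3 in [G]. Since [T] centralises [t], it would then lie in [C]. *)
have defC : C = 'C_G[t].
  apply/eqP; rewrite eqEcard sub_cent_involution //=.
  rewrite -(leq_pmul2r (isT : 0 < 3)) -card_cent_involution //.
  by rewrite -iC Lagrange.
by case/negP: nTC; rewrite defC subsetI sTG sub_cent1.
Qed.

Lemma even_cent_involutions_order : ~~ odd #|C| ->
  exists alpha m : nat, [/\ #|G| = (4 ^ alpha * m)%N, 0 < alpha & m = 3 %[mod 6]].
Proof.
move=> evC; have [P sylP] := Sylow_exists 2 C.
have := card_Sylow2_mod3 evC sylP; rewrite (card_Hall sylP) p_part.
set k := logn 2 _ => k1.
have k_gt0 : 0 < k by rewrite logn_gt0 mem_primes cardG_gt0 dvdn2.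
have [a def_k] : exists a, k = a.*2.
  exists k./2; rewrite -[LHS]odd_double_half.
  case: (odd k) (odd_double_half k) => //.
  (* An odd power of 2 is 2 modulo 3. *)
  move=> dk; exfalso; move: k1; rewrite -dk expnS -mul2n expnM -modnMmr -modnXm.
  by rewrite exp1n.
exists a, (#|C : P| * 3)%N; split; last 1 first.
- have /and3P[_ _] := sylP; rewrite p'natE // dvdn2 negbK.
  by move: #|C : P| => j; lia.
- rewrite mulnA -(Lagrange (normal_sub cent_involutions_normal)).
  rewrite index_cent_involutions_even // -(Lagrange (pHall_sub sylP)).
  by rewrite (card_Hall sylP) p_part -/k def_k -mul2n expnM.
- by lia.
Qed.

End Necessity.

(** * Sufficiency: a criterion, and products with groups of odd order *)

Lemma pertinent_conj3 (gT : finGroupType) (G : {group gT}) a g h :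
    g \in G -> h \in G -> involutions G = [set a; a ^ g; a ^ h] ->
    uniq [:: a; a ^ g; a ^ h] -> pertinent G.
Proof.
move=> Gg Gh defI; rewrite /= !inE negb_or andbT => /andP[/andP[nag nah] ngh].
split.
  rewrite defI setUC cardsU1 cards2 !inE negb_or.
  by rewrite ![a ^ h == _]eq_sym nag nah ngh.
have conja x : x \in involutions G -> exists2 u, u \in G & x = a ^ u.
  rewrite defI !inE -orbA => /or3P[] /eqP->; [|by exists g | by exists h].
  by exists 1; rewrite ?conjg1.
move=> _ _ /conja[u Gu ->] /conja[v Gv ->].
by exists (u^-1 * v); rewrite ?groupM ?groupV // -conjgM mulKVg.
Qed.

Lemma odd_sqrg_eq1 (gT : finGroupType) (H : {group gT}) y :
  odd #|H| -> y \in H -> y ^+ 2 = 1 -> y = 1.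
Proof.
move=> oddH Hy /eqP; rewrite -order_dvdn => oy2; apply/eqP.
rewrite -order_eq1 -dvdn1 -(eqP (_ : coprime #|H| 2)) ?coprimen2 //.
by rewrite dvdn_gcd oy2 order_dvdG.
Qed.

(** The second coordinate of an involution squares to 1 in a group of odd order, so it is trivial:
    the involutions are those of the factor [G]. *)
Lemma pertinent_setX (gT hT : finGroupType) (G : {group gT}) (H : {group hT}) :
  odd #|H| -> pertinent G -> pertinent (setX_group G H).
Proof.
move=> oddH [I3 Iconj].
have defI : involutions (setX_group G H) = setX (involutions G) 1.
  apply/setP=> -[x y]; rewrite in_setX; apply/mem_involutions/andP.
    case=> /setXP[Gx Hy] [x2 y2] nxy.
    have y1 := odd_sqrg_eq1 oddH Hy y2; rewrite {y y2 Hy}y1 in nxy *.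
    split; last exact: set11.
    by apply/mem_involutions; split=> //; apply: contraNneq nxy => ->.
  case=> /mem_involutions[Gx x2 nx] /set1P->; split.
  - by rewrite in_setX Gx group1.
  - by rewrite (_ : (x, 1) ^+ 2 = (x ^+ 2, 1 ^+ 2)) // x2 expg1n.
  - by apply: contra nx => /eqP[->].
split; first by rewrite defI cardsX cards1 I3.
move=> [x y] [x' y']; rewrite defI => /setXP[Ix /set1P->] /setXP[Ix' /set1P->].
have [g Gg ->] := Iconj _ _ Ix Ix'.
exists (g, 1); first by rewrite in_setX Gg group1.
by rewrite (_ : (x, 1) ^ (g, 1) = (x ^ g, 1 ^ 1)) // conj1g.
Qed.

Lemma pertinent_mul_odd (gT : finGroupType) (G : {group gT}) k :
  pertinent G -> exists (hT : finGroupType) (H : {group hT}),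
    pertinent H /\ #|H| = (#|G| * k.*2.+1)%N.
Proof.
move=> pertG; exists _, (setX_group G [set: ('I_k.*2.+1 : finGroupType)]).
split; last by rewrite cardsX cardsT card_ord.
by apply: pertinent_setX; rewrite // cardsT card_ord /= odd_double.
Qed.

(** * Sufficiency: the symmetric group of degree 3 *)

Lemma pertinent_S3 : pertinent [set: 'S_3].
Proof.
pose i0 := @Ordinal 3 0 isT; pose i1 := @Ordinal 3 1 isT.
pose i2 := @Ordinal 3 2 isT.
have I3 (P : 'I_3 -> Prop) : P i0 -> P i1 -> P i2 -> forall i, P i.
  by move=> P0 P1 P2 [[|[|[|i]]] lti] //; rewrite (bool_irrelevance lti isT).
have case3 : forall i, [\/ i = i0, i = i1 | i = i2].
  by apply: I3; [apply: Or31 | apply: Or32 | apply: Or33].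
have J1 : tperm i0 i1 ^ tperm i1 i2 = tperm i0 i2.
  by rewrite tpermJ tpermL tpermD.
have J2 : tperm i0 i1 ^ tperm i0 i2 = tperm i1 i2.
  by rewrite tpermJ tpermL tpermD // tpermC.
apply: (pertinent_conj3 (a := tperm i0 i1) (g := tperm i1 i2) (h := tperm i0 i2));
  rewrite ?in_setT // ?J1 ?J2.
  apply/setP=> s; apply/mem_involutions/idP; rewrite !inE -orbA.
    case=> _ s2 ns.
    have ss i : s (s i) = i by rewrite -permM -expg2 s2 perm1.
    have sE (t : 'S_3) : s i0 = t i0 -> s i1 = t i1 -> s i2 = t i2 -> s = t.
      by move=> *; apply/permP; apply: I3.
    (* Of the 27 possible value triples, only the identity and the three transpositions satisfy
       [ss]. *)
    move: (ss i0) (ss i1) (ss i2).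
    have [] := case3 (s i0) => E0; have [] := case3 (s i1) => E1;
      have [] := case3 (s i2) => E2; rewrite !(E0, E1, E2) // => _ _ _.
    - by case/eqP: ns; apply: sE; rewrite perm1.
    - by rewrite (sE (tperm i1 i2)) ?eqxx ?orbT // ?tpermL ?tpermR ?tpermD.
    - by rewrite (sE (tperm i0 i1)) ?eqxx ?orbT // ?tpermL ?tpermR ?tpermD.
    - by rewrite (sE (tperm i0 i2)) ?eqxx ?orbT // ?tpermL ?tpermR ?tpermD.
  have inv_tperm (i j : 'I_3) : i != j -> tperm i j ^+ 2 = 1 /\ tperm i j != 1.
    move=> nij; split; first by rewrite expg2 tperm2.
    by apply: contra nij => /eqP/permP/(_ i); rewrite tpermL perm1 => ->.
  by case/or3P=> /eqP->; [have [] := inv_tperm i0 i1 isT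
    | have [] := inv_tperm i0 i2 isT | have [] := inv_tperm i1 i2 isT].
rewrite /= !inE negb_or andbT; apply/andP; split; first (apply/andP; split).
- by apply/eqP=> /permP/(_ i0); rewrite !tpermL.
- by apply/eqP=> /permP/(_ i0); rewrite tpermL tpermD.
- by apply/eqP=> /permP/(_ i0); rewrite tpermL tpermD.
Qed.

(** * Sufficiency: extending the square of an abelian group by an automorphism of order 3 *)

Lemma pertinent_sdprod (A : finGroupType) (h : A) :
    abelian [set: A] -> h != 1 -> (forall x : A, x ^+ 2 = 1 <-> x = 1 \/ x = h) ->
  exists (gT : finGroupType) (G : {group gT}),
    pertinent G /\ #|G| = (#|A| ^ 2 * 3)%N.
Proof.
move=> abA nh sq.
have cA (x y : A) : x * y = y * x by apply: (centsP abA); rewrite inE.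
pose B := (A * A)%type : finGroupType.
(* [f] has order [3], and permutes [(h, 1)], [(1, h)] and [(h, h)] cyclically. *)
pose f (u : B) : B := (u.2^-1, u.1 * u.2^-1).
(* Written additively, [f] is a matrix with characteristic polynomial X^2 + X + 1, a divisor of X^3
   - 1. *)
have f3 u : f (f (f u)) = u.
  case: u => x y; rewrite /f /= !invMg !invgK.
  by congr (_, _); rewrite ?mulgKV // [x * _]cA mulgA ?mulVg ?mul1g ?mulgK ?mulgV.
have injf : injective f by apply: (can_inj (g := f \o f)).
pose s := perm injf.
have As : s \in Aut [set: B].
  rewrite inE; apply/andP; split; first by apply/subsetP=> x; rewrite inE.
  apply/morphicP=> -[x y] [x' y'] _ _; rewrite !permE /f.
  (* The group law of [B] is unfolded into coordinates. *)
  change (((y * y')^-1, x * x' * (y * y')^-1) =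
    (y^-1 * y'^-1, x * y^-1 * (x' * y'^-1))).
  rewrite !invMg; congr (_, _); first by rewrite cA.
  by rewrite [y'^-1 * _]cA -!mulgA; congr (_ * _); rewrite !mulgA [x' * _]cA.
have sD : <[s]> \subset Aut [set: B] by rewrite cycle_subG.
pose to := ([Aut [set: B]] \ sD)%gact.
have toE u : to u s = f u by exact: permE.
pose e := sdpair1 to; pose t := sdpair2 to s.
have eJ u : e u ^ t = e (f u).
  by rewrite -toE /e sdpair_act ?inE ?cycle_id.
have hV : h^-1 = h.
  by apply/eqP; rewrite eq_invg_mul -expg2; apply/eqP/sq; right.
have inj_e := injm_sdpair1 to.
have eI u v : (e u == e v) = (u == v).
  by rewrite (inj_in_eq (injmP inj_e)) ?inE.
have e1 : e 1 = 1 by rewrite /e morph1.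
have e2 u : (e u ^+ 2 == 1) = (u ^+ 2 == 1).
  by rewrite -morphX ?inE // -e1 eI.
have os : #[s] = 3.
  apply/prime_nt_dvdP => //; last first.
    rewrite order_dvdn; apply/eqP/permP=> u.
    by rewrite permX /= perm1 !permE.
  rewrite order_eq1; apply/eqP=> /permP/(_ (h, 1)); rewrite permE perm1 => -[].
  by rewrite invg1 => h1; rewrite h1 eqxx in nh.
have := sdprod_sdpair to; set K := _ @* _; set Q := _ @* _ => defT.
have cardQ : #|Q| = 3 by rewrite card_injm ?injm_sdpair2.
have cardK : #|K| = (#|A| ^ 2)%N.
  by rewrite card_injm ?injm_sdpair1 // cardsT card_prod.
exists (sdprod_groupType to), [set: sdprod_groupType to]%G; split; last first.
  by rewrite -(sdprod_card defT) cardQ cardK.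
have [nK _ _ _ _] := sdprod_context defT.
have eJ1 : e (h, 1) ^ t = e (1, h).
  by rewrite eJ /f /= invg1 mulg1.
have eJ2 : e (h, 1) ^ (t ^+ 2) = e (h, h).
  by rewrite expg2 conjgM eJ1 eJ /f /= hV mul1g.
apply: (@pertinent_conj3 (sdprod_groupType to) _ (e (h, 1)) t (t ^+ 2));
  rewrite ?in_setT // ?eJ1 ?eJ2.
  apply/setP=> x; apply/mem_involutions/idP; rewrite !inE -orbA.
    case=> _ x2 nx.
    (* The quotient by [K] has order 3, so the image of [x], whose square is 1, is trivial there. *)
    have Kx : x \in K.
      apply: coset_idr; first by rewrite (subsetP (normal_norm nK)) ?inE.
      apply: (@odd_sqrg_eq1 _ ([set: sdprod_groupType to] / K)%G).
      - rewrite card_quotient ?normal_norm // -(divgS (normal_sub nK)).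
        by rewrite -(sdprod_card defT) cardQ mulKn.
      - by rewrite mem_quotient ?inE.
      - by rewrite -morphX ?x2 ?morph1 // (subsetP (normal_norm nK)) ?inE.
    have [[y z] _ _ def_x] := morphimP Kx.
    rewrite {x Kx}def_x -/e in x2 nx *.
    have /eqP[/sq y2 /sq z2] : (y, z) ^+ 2 == 1 by rewrite -e2 x2.
    rewrite !eI.
    (* Each coordinate is 1 or [h]; the pair [(1, 1)] is excluded by [nx]. *)
    case: y2 nx => ->; case: z2 => ->; rewrite ?eqxx ?orbT //.
    by rewrite [_ (1, 1)]e1 eqxx.
  have inv_e u v : u ^+ 2 = 1 -> v ^+ 2 = 1 -> (u, v) != 1 :> B ->
      e (u, v) ^+ 2 = 1 /\ e (u, v) != 1.
    move=> u2 v2 nuv; rewrite -{2}e1 eI nuv; split=> //; apply/eqP.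
    by rewrite e2 (_ : (u, v) ^+ 2 = (u ^+ 2, v ^+ 2)) // u2 v2.
  have h2 : h ^+ 2 = 1 by apply/sq; right.
  have n1 (u v : A) : u != 1 \/ v != 1 -> (u, v) != 1 :> B.
    by case=> nuv; apply: contra nuv => /eqP[u1 v1]; apply/eqP.
  by case/or3P=> /eqP->; split; rewrite ?inE //; apply inv_e;
    rewrite ?expg1n //; apply: n1; auto.
by rewrite /= !inE !eI !xpair_eqE !eqxx ![1 == h]eq_sym (negPf nh).
Qed.

Lemma pertinent_4X a : exists (gT : finGroupType) (G : {group gT}),
  pertinent G /\ #|G| = (4 ^ a.+1 * 3)%N.
Proof.
(* [A] is the additive group of integers modulo [2 ^ a.+1], in the successor form that carries the
   group structure; [x ^+ 2] is thus x + x, and the only involution is [2 ^ a]. *)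
pose n := (2 ^ a.+1).-1; pose A := 'I_n.+1 : finGroupType.
have def_n : n.+1 = (2 ^ a).*2 by rewrite -mul2n -expnS prednK ?expn_gt0.
have lt_h : 2 ^ a < n.+1 by rewrite def_n -addnn -[ltnLHS]addn0 ltn_add2l expn_gt0.
pose h : A := Ordinal lt_h.
have dvd_n k : (n.+1 %| k.*2) = (2 ^ a %| k).
  by rewrite def_n -!mul2n dvdn_pmul2l.
have cardA : #|A| = n.+1 by rewrite card_ord.
have sq (x : A) : x ^+ 2 = 1 <-> x = 1 \/ x = h.
  have -> : x ^+ 2 = 1 <-> n.+1 %| x.*2.
    rewrite expg2 -addnn /dvdn; split=> [/(congr1 val) /= -> // | /eqP x2].
    exact: val_inj.
  rewrite dvd_n; split=> [/dvdnP[q def_x] | [->|->] //].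
  have: x < (2 ^ a).*2 by rewrite -def_n.
  rewrite def_x -mul2n ltn_pmul2r ?expn_gt0 //.
  case: q def_x => [|[|//]] def_x _; [left | right]; apply: val_inj.
    by rewrite /= def_x.
  by rewrite /= def_x mul1n.
have [|||gT [G [pertG cardG]]] := @pertinent_sdprod A h.
- exact: FinRing.zmod_abelian.
- by rewrite -val_eqE /= -lt0n expn_gt0.
- exact: sq.
exists gT, G; split=> //.
by rewrite cardG cardA def_n -mul2n -expnS -expnM [(_.+1 * 2)%N]mulnC expnM.
Qed.

Local Close Scope group_scope.

Theorem theorem3p9 (n : nat) :
  (exists (gT : finGroupType) (G : {group gT}), pertinent G /\ #|G| = n) <->
  (n = 6 %[mod 12] \/
   exists alpha m : nat, [/\ n = 4 ^ alpha * m, 0 < alpha & m = 3 %[mod 6]]).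
Proof.
split=> [[gT [G [pertG <-]]] |].
  have [/(odd_cent_involutions_order pertG) | evC] :=
      boolP (odd #|'C_G(involutions G)%g|).
    by left.
  by right; apply: even_cent_involutions_order evC.
case=> [n6 | [[|a] [m [-> // _ m3]]]].
  (* If n = 12q + 6, then n = 6(2q + 1). *)
  have [gT [G [pertG cardG]]] := pertinent_mul_odd (n %/ 12) pertinent_S3.
  exists gT, G; split=> //; rewrite cardG cardsT card_Sn.
  by rewrite [RHS](divn_eq n 12) n6 /factorial /=; lia.
have [gT [G [pertG cardG]]] := pertinent_4X a.
(* If m = 6q + 3, then m = 3(2q + 1), the factor 3 being already in [#|G|]. *)
have [hT [H [pertH cardH]]] := pertinent_mul_odd (m %/ 6) pertG.
exists hT, H; split=> //; rewrite cardH cardG -mulnA; congr (_ * _).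
by rewrite [RHS](divn_eq m 6) m3; lia.
Qed.
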